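(* If a (connected) component $\Omega$ of $\mathbb C\setminus\overline{W^2(\mathcal A|_{H_1\times H_1})}$ contains a point $\lambda_0\in\rho(\mathcal A)$, then $\Omega\subset\rho(\mathcal A)$; in particular, if every component of $\mathbb C\setminus\overline{W^2(\mathcal A|_{H_1\times H_1})}$ contains a point $\lambda_0\in\rho(\mathcal A)$, then \[ \sigma(\mathcal A)\subset\overline{W^2(\mathcal A|_{H_1\times H_1})}. \]
   Context: $H$ is a (complex) Hilbert space with inner product $\langle\cdot,\cdot\rangle$ and norm $\|\cdot\|$. $A_0:\mathcal D(A_0)\subset H\to H$ is a self-adjoint, uniformly positive linear operator with $0\in\rho(A_0)$. $H_{1/2}:=\mathcal D(A_0^{1/2})$ with norm $\|z\|_{H_{1/2}}=\|A_0^{1/2}z\|$ and inner product $\langle x,y\rangle_{H_{1/2}}=\langle A_0^{1/2}x,A_0^{1/2}y\rangle$; $H_{-1/2}$ is the dual of $H_{1/2}$ with respect to the pivot space $H$, i.e. the completion of $H$ with respect to $\|A_0^{-1/2}z\|$; $\langle\cdot,\cdot\rangle_{H_{-1/2}\times H_{1/2}}$ is the duality pairing, with $\langle z',z\rangle_{H_{-1/2}\times H_{1/2}}=\langle z',z\rangle$ for $z'\in H$, $z\in H_{1/2}$. $H_1:=\mathcal D(A_0)$. $A_0$ extends to a bounded operator $H_{1/2}\to H_{-1/2}$, again denoted $A_0$. $D:H_{1/2}\to H_{-1/2}$ is a bounded linear operator such that $\mathrm{Re}\,\langle Dz,z\rangle_{H_{-1/2}\times H_{1/2}}\ge 0$ for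 all $z\in H_{1/2}$, and $D$ maps $H_1$ into $H$. The operator $\mathcal A$ in $H_{1/2}\times H$ is $\mathcal A=\begin{bmatrix}0&I\\-A_0&-D\end{bmatrix}$ with $\mathcal D(\mathcal A)=\{(z,w)^\top\in H_{1/2}\times H_{1/2}\mid A_0z+Dw\in H\}\supset H_1\times H_1$. Quadratic numerical range: for $f,g\in H_1\setminus\{0\}$ let \[ \mathcal A_{f,g}=\begin{bmatrix}0&\frac{\langle g,f\rangle_{H_{1/2}}}{\|f\|_{H_{1/2}}\|g\|}\\[1ex]-\frac{\langle A_0f,g\rangle}{\|f\|_{H_{1/2}}\|g\|}&-\frac{\langle Dg,g\rangle}{\|g\|^2}\end{bmatrix}\in M_2(\mathbb C), \] and let $W^2(\mathcal A|_{H_1\times H_1})$ be the set of all eigenvalues of all matrices $\mathcal A_{f,g}$, $f,g\in H_1\setminus\{0\}$. $\rho(\mathcal A)$ and $\sigma(\mathcal A)$ denote resolvent set and spectrum. *)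

(* Defs.v *)
From HB Require Import structures.
From mathcomp Require Import all_boot all_order all_algebra.
From mathcomp Require Import complex.
From mathcomp Require Import all_classical all_reals all_analysis.

Set Implicit Arguments.
Unset Strict Implicit.
Unset Printing Implicit Defensive.

Import Order.TTheory GRing.Theory Num.Theory.
Import numFieldNormedType.Exports.

Local Open Scope classical_set_scope.
Local Open Scope ring_scope.
Local Open Scope complex_scope.

(* The inner product is linear in its first argument and conjugate-linear in
   the second one. *)
HB.mixin Record isHilbert (R : realType) H & CompleteNormedModule R[i] H := {
  inner : {dot H for @Num.conj R[i]};
  normE_inner : forall x : H, `|x| ^+ 2 = inner x x }.

#[short(type="hilbertType")]
HB.structure Definition Hilbert (R : realType) :=
  {H of isHilbert R H & CompleteNormedModule R[i] H}.

(* Linear operators with a domain: [app] is only meaningful on [dom]. *)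
Record linop (K : pzRingType) (U V : lmodType K) := Linop {
  dom : set U;
  app :> U -> V;
  dom0 : dom 0;
  dom_lin : forall a x y, dom x -> dom y -> dom (a *: x + y);
  app_lin : forall a x y, dom x -> dom y ->
    app (a *: x + y) = a *: app x + app y }.

Section linop_theory.
Context {K : pzRingType} {U V : lmodType K} (T : linop U V).

Lemma app0 : T 0 = 0.
Proof.
have := app_lin 1 (dom0 T) (dom0 T); rewrite !scale1r addr0 => h.
by apply: (addrI (T 0)); rewrite addr0 -h.
Qed.

Lemma appD x y : dom T x -> dom T y -> T (x + y) = T x + T y.
Proof. by move=> dx dy; have := app_lin 1 dx dy; rewrite !scale1r. Qed.

Lemma appZ a x : dom T x -> T (a *: x) = a *: T x.
Proof. by move=> dx; have := app_lin a dx (dom0 T); rewrite app0 !addr0. Qed.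

End linop_theory.

Definition resolvent_set (K : numFieldType) (X : normedModType K)
    (T : linop X X) : set K^o :=
  [set l | exists Rl : {linear X -> X},
    [/\ bounded_near Rl (nbhs 0),
        forall y, dom T (Rl y) /\ T (Rl y) - l *: Rl y = y &
        forall x, dom T x -> Rl (T x - l *: x) = x]].

Definition spectrum (K : numFieldType) (X : normedModType K)
    (T : linop X X) : set K^o :=
  ~` resolvent_set T.

Definition is_component (T : topologicalType) (A Omega : set T) :=
  exists2 x, A x & Omega = connected_component A x.

Section hilbert_operators.
Context {R : realType} {H : hilbertType R}.
Implicit Types A S : linop H H.

Definition graph A : set (H * H) :=
  [set xy | dom A xy.1 /\ A xy.1 = xy.2].

Definition adjoint_graph A : set (H * H) :=
  [set yz | forall x, dom A x -> inner (A x) yz.1 = inner x yz.2].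

Definition selfadjoint A := dense (dom A) /\ adjoint_graph A = graph A.

(* The order of R[i] compares imaginary parts for equality: the inequality
   below says in particular that [inner (A x) x] is real. *)
Definition uniformly_positive A :=
  exists2 c : R[i], 0 < c & forall x, dom A x -> c * `|x| ^+ 2 <= inner (A x) x.

Definition nonnegative A := forall x, dom A x -> 0 <= inner (A x) x.

End hilbert_operators.

Record posop (R : realType) (H : hilbertType R) := Posop {
  posop_op :> linop H H;
  posop_selfadjoint : selfadjoint posop_op;
  posop_uniformly_positive : uniformly_positive posop_op;
  posop_resolvent0 : resolvent_set posop_op 0 }.

(* The square root of A0 is its unique nonnegative selfadjoint square root;
   the last two fields say that S S = A0, domains included. *)
Record sqrtop (R : realType) (H : hilbertType R) (A0 : posop H) := Sqrtop {
  sqrtop_op :> linop H H;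
  sqrtop_selfadjoint : selfadjoint sqrtop_op;
  sqrtop_nonnegative : nonnegative sqrtop_op;
  sqrtop_dom : dom A0 = [set x | dom sqrtop_op x /\ dom sqrtop_op (sqrtop_op x)];
  sqrtop_sqr : forall x, dom A0 x -> sqrtop_op (sqrtop_op x) = A0 x }.

Section energy_space.
Context {R : realType} {H : hilbertType R} {A0 : posop H}.
Variable S : sqrtop A0.

Lemma sqrtop_ker0 x : dom S x -> S x = 0 -> x = 0.
Proof.
move=> dx Sx0; have dAx : dom A0 x.
  by rewrite (sqrtop_dom S)/=; split => //; rewrite Sx0; exact: dom0.
have [c c0 /(_ x dAx)] := posop_uniformly_positive A0.
rewrite -(sqrtop_sqr S dAx) Sx0 app0 linear0l pmulr_rle0// => x0.
by apply/eqP; rewrite -normr_eq0 -sqrf_eq0 eq_le x0 exprn_ge0.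
Qed.

Lemma sqrtop_surj h : exists2 x, dom S x & S x = h.
Proof.
have [Rl [_ /(_ h)[dRh ARh] _]] := posop_resolvent0 A0.
move: (dRh); rewrite {1}(sqrtop_dom S) => -[_ dSRh].
by exists (S (Rl h)) => //; rewrite sqrtop_sqr//; move: ARh; rewrite scale0r subr0.
Qed.

Definition dom_pred : {pred H} := [pred x | x \in dom S].

Lemma dom_pred_submod : submod_closed dom_pred.
Proof.
split=> [|a x y]; rewrite !inE; first exact: dom0.
exact: dom_lin.
Qed.

HB.instance Definition _ :=
  GRing.isSubmodClosed.Build R[i] H dom_pred dom_pred_submod.

Definition Hhalf : Type := {x : H | x \in dom_pred}.

HB.instance Definition _ := SubChoice.copy Hhalf {x : H | x \in dom_pred}.
HB.instance Definition _ := [SubChoice_isSubLmodule of Hhalf by <:].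

Lemma HhalfP (z : Hhalf) : dom S (val z).
Proof. by have := valP z; rewrite inE. Qed.

Definition Hhalf_norm (z : Hhalf) : R[i] := `|S (val z)|.

Lemma Hhalf_normD x y : Hhalf_norm (x + y) <= Hhalf_norm x + Hhalf_norm y.
Proof. by rewrite /Hhalf_norm appD ?ler_normD//; exact: HhalfP. Qed.

Lemma Hhalf_normZ (l : R[i]) x : Hhalf_norm (l *: x) = `|l| * Hhalf_norm x.
Proof. by rewrite /Hhalf_norm appZ ?normrZ//; exact: HhalfP. Qed.

Lemma Hhalf_norm_eq0 x : Hhalf_norm x = 0 -> x = 0.
Proof.
by move/normr0_eq0/(sqrtop_ker0 (HhalfP x)) => x0; apply: val_inj.
Qed.

HB.instance Definition _ := Lmodule_isNormed.Build R[i] Hhalf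
  Hhalf_normD Hhalf_normZ Hhalf_norm_eq0.

Definition Hhalf_inner (x y : Hhalf) : R[i] := inner (S (val x)) (S (val y)).

End energy_space.

(* H_{-1/2}: a completion of H for the norm h |-> `|S^-1 h|, with its duality
   pairing with H_{1/2}. As S is onto, the vectors h are written S w.
   The fields determine everything up to a unique isometric isomorphism. *)
Record Hneg (R : realType) (H : hilbertType R) (A0 : posop H)
    (S : sqrtop A0) := MkHneg {
  Hneg_sort :> completeNormedModType R[i];
  embed : {linear H -> Hneg_sort};
  embed_norm : forall w, dom S w -> `|embed (S w)| = `|w|;
  embed_dense : dense (range embed);
  pairing : {bilinear Hneg_sort -> Hhalf S -> R[i] | *%R & Num.conj \; *%R};
  pairing_bounded : forall phi z, `|pairing phi z| <= `|phi| * `|z|;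
  pairing_embed : forall h z, pairing (embed h) z = inner h (val z) }.

Section block_operator.
Context {R : realType} {H : hilbertType R} {A0 : posop H} {S : sqrtop A0}.
Context {Hm : Hneg S}.
(* [A0x] stands for the extension of A0 to a bounded operator. *)
Variables A0x D : {linear Hhalf S -> Hm}.

Lemma embed_inj : injective (embed Hm).
Proof.
apply: raddf_inj => h; have [w dw <-] := sqrtop_surj S h => /eqP.
by rewrite -normr_eq0 embed_norm// normr_eq0 => /eqP ->; rewrite app0.
Qed.

Definition unembed (phi : Hm) : H := get [set h | embed Hm h = phi].

Lemma embedK : cancel (embed Hm) unembed.
Proof.
move=> h; apply: embed_inj.
exact: (@getI _ [set k | embed Hm k = embed Hm h] h).
Qed.

Definition lift (w : H) : Hhalf S := insubd 0 w.

Lemma liftK w : dom S w -> val (lift w) = w.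
Proof. by move=> dw; rewrite insubdK// inE. Qed.

Definition block_dom : set (Hhalf S * H) :=
  [set x | dom S x.2 /\ range (embed Hm) (A0x x.1 + D (lift x.2))].

Definition block_app (x : Hhalf S * H) : Hhalf S * H :=
  (lift x.2, - unembed (A0x x.1 + D (lift x.2))).

Lemma lift_lin a w w' : dom S w -> dom S w' ->
  lift (a *: w + w') = a *: lift w + lift w'.
Proof.
move=> dw dw'; apply: val_inj.
by rewrite liftK ?linearP/= ?liftK//; exact: dom_lin.
Qed.

Lemma block_formula_lin a (x y : Hhalf S * H) : dom S x.2 -> dom S y.2 ->
  A0x (a *: x + y).1 + D (lift (a *: x + y).2) =
  a *: (A0x x.1 + D (lift x.2)) + (A0x y.1 + D (lift y.2)).
Proof. by move=> dx dy; rewrite /= lift_lin// !linearP scalerDr addrACA. Qed.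

Lemma block_dom0 : block_dom 0.
Proof.
split; first exact: dom0.
exists 0 => //=; rewrite !linear0 add0r.
have -> : lift 0 = 0 by apply: val_inj; rewrite liftK//; exact: dom0.
by rewrite linear0.
Qed.

Lemma block_dom_lin a x y :
  block_dom x -> block_dom y -> block_dom (a *: x + y).
Proof.
move=> [dx [h _ hE]] [dy [k _ kE]]; split; first exact: dom_lin.
by exists (a *: h + k) => //; rewrite block_formula_lin// linearP hE kE.
Qed.

Lemma block_app_lin a x y : block_dom x -> block_dom y ->
  block_app (a *: x + y) = a *: block_app x + block_app y.
Proof.
move=> [dx [h _ hE]] [dy [k _ kE]].
rewrite /block_app block_formula_lin// -hE -kE -linearP !embedK.
by rewrite lift_lin// opprD -scalerN.
Qed.

(* [[0, I], [- A0, - D]] on H_{1/2} x H. The product carries the maximum of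
   the two norms, which is equivalent to the Hilbert norm of the product. *)
Definition block_op : linop (Hhalf S * H)%type (Hhalf S * H)%type :=
  Linop block_dom0 block_dom_lin block_app_lin.

Definition H1 : set (Hhalf S) := [set z | dom A0 (val z)].

(* On H_1, where D takes values in H, [pairing (D g) g] is the inner product
   of D g and g. *)
Definition qnr_mx (f g : Hhalf S) : 'M[R[i]]_2 :=
  \matrix_(i, j)
    if i == 0 then
      if j == 0 then 0 else Hhalf_inner g f / (`|f| * `|val g|)
    else
      if j == 0 then - (inner (A0 (val f)) (val g) / (`|f| * `|val g|))
      else - (pairing Hm (D g) g / `|val g| ^+ 2).

Definition qnr : set R[i]^o :=
  [set l | exists f g,
    [/\ H1 f, H1 g, f != 0, g != 0 & eigenvalue (qnr_mx f g) l]].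

End block_operator.

(* Main.v *)
Require Import Defs.
From HB Require Import structures.
From mathcomp Require Import all_boot all_order all_algebra.
From mathcomp Require Import complex ring.
From mathcomp Require Import all_classical all_reals all_analysis.
Import Order.TTheory GRing.Theory Num.Theory.
Import numFieldNormedType.Exports.
Local Open Scope classical_set_scope.
Local Open Scope ring_scope.
Local Open Scope complex_scope.

(** Write A for the block operator and W2 for the closure of the quadratic
    numerical range.  The whole theorem rests on a lower bound

      k |x| <= |A x - m x|   for x in the domain of A,

    with k > 0 independent of m near any given point outside W2
    ([block_op_lower_bound_near]).  Where such a bound holds, the norm of the
    resolvent at a point of the resolvent set is at most 1/k, hence the Neumann
    series, here in the form of a contraction, carries membership in the
    resolvent set to every point at distance less than k
    ([resolvent_set_dist_lt]).  As k is locally uniform, the resolvent set is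
    both open and closed relatively to the complement of W2, so that it contains
    every component that it meets ([resolvent_set_connected]).

    For x = (f, g) with f, g nonzero in H_1, the lower bound is a fact about the
    two-by-two matrix A_{f,g}.  Pairing the two components of y = A x - l x with
    f/|f| and g/|g| gives A_{f,g} p - l p = r, where p = (|f|, |g|) and the
    entries of r are at most |y|.  Both eigenvalues l1, l2 of A_{f,g} are at
    distance at least e from l.  The entries of A_{f,g} are not bounded in f and
    g, but its off-diagonal entries have equal moduli, so that l1 and l2 bound
    them: the product of the off-diagonal entries is - l1 l2 and the diagonal
    one is l1 + l2.  Cramer's rule then divides quantities of order
    max |l - li| by |l - l1| |l - l2|, which is at least e max |l - li|
    ([mx2_solution_bound], [qnr_lower_bound]).

    Vectors of H_1 x H_1 with a vanishing component are limits of the previous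
    ones along a line ([lower_bound_perturb]).  Finally H_1 x H_1 is a core of A
    ([block_op_core]): for (z, w) in the domain and g in H_1 close to w, solving
    A0 f + D g = A0 z + D w yields f in H_1, since D g is in H; f is close to z
    because A0 is isometric from H_{1/2} to H_{-1/2}, and A (f, g) differs from
    A (z, w) by (g - w, 0) only. *)

(** * Products of complete normed modules *)

(** Makes the pointed uniform structure of a product available, which the
    completeness instances below extend. *)
HB.saturate prod.

Section prod_complete.
Context {U V : completeType}.

Lemma prod_cauchy_cvg (F : set_system (U * V)) :
  ProperFilter F -> cauchy F -> cvg F.
Proof.
move=> FF cF.
have cvgU : cvg (fst @ F).
  apply: cauchy_cvg => A entA.
  have entB := prod_entP entA (@entourageT V).
  have [[P Q] /= [FP FQ] PQ] := cF _ entB.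
  exists (fst @` P, fst @` Q) => /=.
    split; [apply: filterS FP|apply: filterS FQ] => x; exact: imageP.
  by move=> [_ _] /= [[x Px <-] [y Qy <-]]; have [] := PQ (x, y) (conj Px Qy).
have cvgV : cvg (snd @ F).
  apply: cauchy_cvg => A entA.
  have entB := prod_entP (@entourageT U) entA.
  have [[P Q] /= [FP FQ] PQ] := cF _ entB.
  exists (snd @` P, snd @` Q) => /=.
    split; [apply: filterS FP|apply: filterS FQ] => x; exact: imageP.
  by move=> [_ _] /= [[x Px <-] [y Qy <-]]; have [] := PQ (x, y) (conj Px Qy).
apply/cvg_ex; exists (lim (fst @ F), lim (snd @ F)).
move=> A [[P Q] /= [nP nQ] PQ]; have FP : F (fst @^-1` P) := cvgU _ nP.
have FQ : F (snd @^-1` Q) := cvgV _ nQ.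
by apply: (@filterS _ F _ _ _ _ (filterI FP FQ)) => -[x y] /= xy; exact: PQ.
Qed.

HB.instance Definition _ :=
  Uniform_isComplete.Build (U * V)%type prod_cauchy_cvg.

End prod_complete.

HB.instance Definition _ (K : numFieldType) (U V : completeNormedModType K) :=
  Complete.copy (U * V)%type (U * V)%type.

Section prod_norm_theory.
Context {K : numFieldType} {U V : normedModType K}.

(** An upper bound on the norm of a pair is usually proved on each component;
    stating this with a predicate covers the bounds on multiples of the norm. *)
Lemma prod_norm_ind (P : K -> Prop) (x : U * V) :
  P `|x.1| -> P `|x.2| -> P `|x|.
Proof. by rewrite prod_normE maxEle; case: ifP. Qed.

Lemma prod_norm_ge (x : U * V) : `|x.1| <= `|x| /\ `|x.2| <= `|x|.
Proof.
have cmp := real_comparable (normr_real x.1) (normr_real x.2).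
by rewrite prod_normE !(comparable_le_max _ cmp) !lexx orbT.
Qed.

End prod_norm_theory.

(** * Contractions over the complex numbers *)

Lemma complex_expr_lt {R : realType} (q e : R[i]) :
  0 <= q -> q < 1 -> 0 < e -> exists n, q ^+ n < e.
Proof.
move=> q0 q1 e0.
have qE := RRe_real (ger0_real q0); have eE := RRe_real (gtr0_real e0).
move: q0 q1 e0; rewrite -qE -eE -[0]/(0%:C) -[1]/(1%:C) lecR !ltcR.
set r := complex.Re q; set d := complex.Re e => r0 r1 d0.
have : (1 * r ^+ n : R) @[n --> \oo] --> 0.
  by apply: cvg_geometric; rewrite ger0_norm.
move/cvgrPdist_lt => /(_ d d0) [N _ /(_ N (leqnn N))] /=.
rewrite sub0r normrN mul1r ger0_norm ?exprn_ge0// => h.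
by exists N; rewrite -rmorphXn/= ltcR.
Qed.

(** Banach's theorem for complex normed spaces.  Instead of summing a geometric
    series, the iterates are compared to the starting point: that distance is at
    most C, the solution of C = |x 0 - x 1| + q C, and n applications of the map
    contract it by q ^+ n. *)
Lemma contraction_fixed_point {R : realType} {X : completeNormedModType R[i]}
    (F : X -> X) (q : R[i]) : 0 <= q -> q < 1 ->
  (forall x y, `|F x - F y| <= q * `|x - y|) -> exists p, F p = p.
Proof.
move=> q0 q1 Fq; pose x n : X := iter n F 0.
have q1' : 0 < 1 - q by rewrite subr_gt0.
pose C := `|x 0%N - x 1%N| / (1 - q).
have C0 : 0 <= C by rewrite divr_ge0// ltW.
have dist0 m : `|x 0%N - x m| <= C.
  elim: m => [|m IH]; first by rewrite subrr normr0.
  apply: le_trans (ler_distD (x 1%N) _ _) _.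
  have -> : C = `|x 0%N - x 1%N| + q * C.
    by rewrite /C; field; rewrite gt_eqF.
  by rewrite lerD2l (le_trans (Fq _ _))// ler_wpM2l.
have dist n m : `|x n - x (n + m)%N| <= q ^+ n * C.
  elim: n => [|n IH]; first by rewrite expr0 mul1r dist0.
  by rewrite addSn (le_trans (Fq _ _))// exprS -mulrA ler_wpM2l.
have /cvg_ex[p xp] : cvgn x.
  apply/cauchy_cvgP/cauchyP => e e0.
  have C1 : 0 < C + 1 by rewrite ltr_wpDl.
  have [N qN] := complex_expr_lt _ _ q0 q1 (divr_gt0 e0 C1).
  exists (x N); rewrite -ball_normE; exists N => // n /= Nn.
  rewrite -(subnKC Nn) (le_lt_trans (dist _ _))//.
  rewrite (@le_lt_trans _ _ (q ^+ N * (C + 1)))//.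
    by rewrite ler_wpM2l ?exprn_ge0// lerDl.
  by rewrite -ltr_pdivlMr.
exists p; apply/eqP; rewrite -subr_eq0 -normr_le0.
apply/ler_addgt0Pl => e e0; rewrite addr0.
move/cvgrPdist_lt : xp => /(_ _ (divr_gt0 e0 (ltr0Sn _ 1))) [N _ xN].
rewrite (le_trans (ler_distD (x N.+1) _ _))// [e]splitr lerD//.
  rewrite (le_trans (Fq _ _))//.
  rewrite (le_trans _ (ltW (xN N (leqnn _))))//.
  by rewrite ler_piMl// ltW.
by rewrite distrC ltW// xN//=.
Qed.

(** * Resolvent sets and lower bounds *)

Lemma appB {K : pzRingType} {U V : lmodType K} {T : linop U V} {x y} :
  dom T x -> dom T y -> T (x - y) = T x - T y.
Proof.
move=> dx dy; have := app_lin (-1) dy dx.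
by rewrite !scaleN1r addrC => ->; rewrite addrC.
Qed.

Lemma domB {K : pzRingType} {U V : lmodType K} {T : linop U V} {x y} :
  dom T x -> dom T y -> dom T (x - y).
Proof. by move=> dx dy; have := dom_lin (-1) dy dx; rewrite scaleN1r addrC. Qed.

(** The lower bound gives both injectivity and the boundedness of the inverse;
    linearity of the inverse follows from injectivity. *)
Lemma resolvent_set_lower_bound {K : numFieldType} {X : normedModType K}
    (T : linop X X) (l : K) (k : K) : 0 < k ->
  (forall x, dom T x -> k * `|x| <= `|T x - l *: x|) ->
  (forall y, exists2 x, dom T x & T x - l *: x = y) ->
  resolvent_set T l.
Proof.
move=> k0 Tk Tsurj.
have inj x x' : dom T x -> dom T x' -> T x - l *: x = T x' - l *: x' -> x = x'.
  move=> dx dx' E; apply/eqP; rewrite -subr_eq0 -normr_le0 -(pmulr_rle0 _ k0).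
  rewrite (le_trans (Tk _ (domB dx dx')))// appB// scalerBr.
  by rewrite opprD addrACA E -opprD subrr normr0.
have [r rP] : {r : X -> X & forall y, dom T (r y) /\ T (r y) - l *: r y = y}.
  exists (fun y => sval (cid2 (Tsurj y))) => y.
  by case: cid2.
have r_lin : linear r.
  move=> c x y; have [dx Ex] := rP x; have [dy Ey] := rP y.
  have [dr Er] := rP (c *: x + y).
  apply: inj => //; first exact: dom_lin.
  rewrite Er app_lin// scalerDr scalerA mulrC -scalerA opprD addrACA -scalerBr.
  by rewrite Ex Ey.
pose rL : {linear X -> X} :=
  HB.pack r (GRing.isLinear.Build K X X *:%R r r_lin).
exists rL; split=> [|//|x dx]; last first.
  have [dr Er] := rP (T x - l *: x).
  exact: inj.
apply/linear_boundedP; near=> M => y /=.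
have [dr Er] := rP y.
have := Tk _ dr; rewrite Er -ler_pdivlMl// => /le_trans; apply.
rewrite ler_wpM2r//; near: M; apply: nbhs_pinfty_ge.
by rewrite rpredV gtr0_real.
Unshelve. all: by end_near. Qed.

(** With r the resolvent at m, the equation T x - l x = y is equivalent to
    x = r (y + (l - m) x), and |l - m| |r| <= |l - m| / k < 1. *)
Lemma resolvent_set_dist_lt {R : realType} {X : completeNormedModType R[i]}
    (T : linop X X) (m l k : R[i]) :
  (forall x, dom T x -> k * `|x| <= `|T x - m *: x|) -> `|l - m| < k ->
  resolvent_set T m -> resolvent_set T l.
Proof.
move=> Tk lm [r [_ rP _]].
have k0 : 0 < k := le_lt_trans (normr_ge0 _) lm.
have rk y : k * `|r y| <= `|y|.
  by have [dr {2}<-] := rP y; exact: Tk.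
apply: (@resolvent_set_lower_bound _ _ _ _ (k - `|l - m|)) => [|x dx|y].
- by rewrite subr_gt0.
- rewrite mulrBl -normrZ lerBlDr (le_trans (Tk _ dx))//.
  rewrite (le_trans _ (ler_normD _ _))// scalerBl addrA.
  by rewrite addrNK.
pose F x := r (y + (l - m) *: x).
have [|||p pE] := @contraction_fixed_point _ _ F (`|l - m| / k).
- by rewrite divr_ge0// ltW.
- by rewrite ltr_pdivrMr// mul1r.
- move=> x x'; rewrite /F -linearB opprD addrACA subrr add0r -scalerBr.
  by rewrite mulrAC ler_pdivlMr// mulrC -normrZ rk.
have [dp Ep] := rP (y + (l - m) *: p); rewrite -/(F p) pE in dp Ep.
exists p => //; apply: (addIr ((l - m) *: p)); rewrite -Ep scalerBl.
by rewrite addrA addrNK.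
Qed.

(** The local uniformity of k makes it larger than the distance between any two
    points of a small ball, so that such a ball is either contained in the
    resolvent set or disjoint from it. *)
Lemma resolvent_set_connected {R : realType} {X : completeNormedModType R[i]}
    (T : linop X X) (C : set R[i]^o) : connected C ->
  (forall l : R[i]^o, C l -> exists2 k, 0 < k &
    \forall m \near l, forall x, dom T x -> k * `|x| <= `|T x - m *: x|) ->
  C `&` resolvent_set T !=set0 -> C `<=` resolvent_set T.
Proof.
move=> Cconn Tk Cres.
have locconst l : C l -> exists2 e, 0 < e & forall m n : R[i]^o,
    ball l e m -> ball l e n -> resolvent_set T m -> resolvent_set T n.
  move=> /Tk[k k0 /nbhs_ballP[e /= e0 lk]].
  (* Radius k / 2 makes two points of the ball closer than k to each other. *)
  have [d [d0 de dk]] : exists d : R[i], [/\ 0 < d, d <= e & d <= k / 2].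
    exists (Num.min e (k / 2)).
    have cmp : e >=< k / 2 by rewrite real_comparable ?gtr0_real// divr_gt0.
    rewrite comparable_lt_min// !(comparable_ge_min _ cmp) !lexx orbT e0.
    by rewrite divr_gt0.
  exists d => // m n lm ln.
  apply: (@resolvent_set_dist_lt _ _ _ _ _ k).
    by apply: lk; exact: le_ball lm.
  rewrite [k]splitr; move: lm ln; rewrite -!ball_normE /= => lm ln.
  rewrite (le_lt_trans (ler_distD l _ _))// ltrD//.
    by rewrite distrC (lt_le_trans ln).
  by rewrite (lt_le_trans lm).
suff <- : C `&` resolvent_set T = C by move=> l [].
apply: Cconn => //.
- exists (resolvent_set T)^°.
    exact: open_interior.
  apply/seteqP; split=> l [Cl rl]; split=> //; last exact: interior_subset.
  have [e e0 le] := locconst l Cl.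
  apply/nbhs_ballP; exists e => //= m lm; apply: le rl => //; exact: ballxx.
- exists (closure (resolvent_set T)); first exact: closed_closure.
  apply/seteqP; split=> l [Cl rl]; split=> //; first exact: subset_closure.
  have [e e0 le] := locconst l Cl.
  have [m [rm lm]] := rl _ (nbhsx_ballx l e e0).
  by apply: le rm => //; exact: ballxx.
Qed.

(** Both sides of the estimate are continuous for the graph norm of T, so it is
    enough to have it on a core.  This is phrased with explicit approximations
    because T x is not continuous in x. *)
Lemma lower_bound_approx {K : numFieldType} {X : normedModType K}
    (T : linop X X) (l a b : K) (x : X) : 0 <= a -> 0 <= b -> dom T x ->
  (forall e, 0 < e -> exists x', [/\ dom T x', `|x - x'| <= e,
      `|T x - T x'| <= e & a * `|x'| <= b * `|T x' - l *: x'|]) ->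
  a * `|x| <= b * `|T x - l *: x|.
Proof.
move=> a0 b0 dx approx; apply/ler_addgt0Pl => e e0.
pose c := a + b * (1 + `|l|).
have c0 : 0 <= c by rewrite addr_ge0// mulr_ge0// addr_ge0.
have c1 : 0 < c + 1 by rewrite ltr_wpDl.
have [x' [dx' xx' Txx' bx']] := approx _ (divr_gt0 e0 c1).
set n := e / (c + 1) in xx' Txx'.
have n0 : 0 <= n := le_trans (normr_ge0 _) xx'.
have cn : c * n <= e.
  by rewrite /n mulrA ler_pdivrMr// mulrC ler_pM2l// lerDl.
have x_x' : `|x| <= `|x'| + n.
  by rewrite -lerBlDl (le_trans _ xx')// lerB_dist.
have Tx' : `|T x' - l *: x'| <= `|T x - l *: x| + (1 + `|l|) * n.
  have -> : T x' - l *: x' = T x - l *: x - (T x - T x') + l *: (x - x').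
    by rewrite opprB [X in _ = X + _]addrC addrA subrK scalerBr addrA subrK.
  rewrite (le_trans (ler_normD _ _))// mulrDl mul1r addrA lerD//.
    by rewrite (le_trans (ler_normB _ _))// lerD2l.
  by rewrite normrZ ler_wpM2l.
apply: (le_trans (ler_wpM2l a0 x_x')); rewrite mulrDr.
apply: (@le_trans _ _ (b * (`|T x - l *: x| + (1 + `|l|) * n) + a * n)).
  by rewrite lerD2r (le_trans bx')// ler_wpM2l.
rewrite mulrDr -addrA addrC lerD2r (le_trans _ cn)//.
by rewrite [leRHS]mulrDl addrC lerD2l mulrA.
Qed.

(** The vectors t z + x tend to x in the graph norm as t tends to 0. *)
Lemma lower_bound_perturb {K : numFieldType} {X : normedModType K}
    (T : linop X X) (l a b : K) (x z : X) : 0 <= a -> 0 <= b ->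
  dom T x -> dom T z ->
  (forall t : K, t != 0 ->
     a * `|t *: z + x| <= b * `|T (t *: z + x) - l *: (t *: z + x)|) ->
  a * `|x| <= b * `|T x - l *: x|.
Proof.
move=> a0 b0 dx dz bt; apply: lower_bound_approx => // e e0.
pose c := `|z| + `|T z| + 1.
have c0 : 0 < c by rewrite ltr_wpDl// addr_ge0.
pose t := e / c; have t0 : 0 < t by rewrite divr_gt0.
have small y : y <= c -> t * y <= e.
  by move=> yc; rewrite /t mulrAC ler_pdivrMr// ler_pM2l.
exists (t *: z + x); split; last by apply: bt; rewrite gt_eqF.
- exact: dom_lin.
- rewrite opprD addrCA subrr addr0 normrN normrZ gtr0_norm// small//.
  by rewrite /c -addrA lerDl addr_ge0.
- rewrite app_lin// opprD addrCA subrr addr0 normrN normrZ gtr0_norm// small//.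
  by rewrite /c -addrA addrCA lerDl addr_ge0.
Qed.

(** * Eigenvalues and resolvents of two-by-two matrices *)

Lemma quadratic_roots {C : numClosedFieldType} (s p : C) :
  exists l1 l2 : C, l1 + l2 = s /\ l1 * l2 = p.
Proof.
have r2 := sqrtCK (s ^+ 2 - 4 * p); set r := sqrtC _ in r2.
exists ((s + r) / 2), ((s - r) / 2); split; first by field.
have -> : (s + r) / 2 * ((s - r) / 2) = (s ^+ 2 - r ^+ 2) / 4 by field.
by rewrite r2; field.
Qed.

(** The hypothesis says that the characteristic polynomial vanishes at l. *)
Lemma eigenvalue_mx2 {F : fieldType} (M : 'M[F]_2) (l : F) :
  (M 0 0 - l) * (M 1 1 - l) = M 0 1 * M 1 0 -> eigenvalue M l.
Proof.
move=> ML; rewrite /eigenvalue /eigenspace kermx_eq0 row_free_unit unitmxE.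
rewrite unitfE negbK (expand_det_row _ 0) !big_ord_recl big_ord0.
rewrite /cofactor !det_mx11 !mxE /= addr0 expr0 expr1 mul1r.
have -> : lift 0 0 = 1 :> 'I_2 by apply: val_inj.
have -> : lift 1 0 = 0 :> 'I_2 by apply: val_inj.
rewrite /= !mulr0n !mulr1n !subr0 ML.
by rewrite mulN1r mulrN subrr.
Qed.

(** The resolvent of the matrix with rows (0, b) and (c, d), with eigenvalues l1
    and l2, at a point l at distance at least e from both.  The bound does not
    involve b, c, d: their size is controlled by m = max |l - li|, since
    |b|^2 = |l1 l2| and d = l1 + l2, and the determinant is at least e m. *)
Lemma mx2_solution_bound {C : numClosedFieldType}
    (l l1 l2 b c d u v p q e Y : C) :
    `|c| = `|b| -> l1 + l2 = d -> l1 * l2 = - (b * c) ->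
    0 < e -> e <= `|l - l1| -> e <= `|l - l2| ->
    - l * p + b * q = u -> c * p + (d - l) * q = v -> `|u| <= Y -> `|v| <= Y ->
  e ^+ 2 * `|p| <= (3 * e + 2 * `|l|) * Y /\
  e ^+ 2 * `|q| <= (3 * e + 2 * `|l|) * Y.
Proof.
move=> cb l12 l12M e0.
wlog le12 : l1 l2 l12 l12M / `|l - l1| <= `|l - l2| => [hwlog el1 el2|].
  case/orP: (real_leVge (normr_real (l - l1)) (normr_real (l - l2))) => le12.
    exact: (hwlog l1 l2).
  by apply: (hwlog l2 l1) => //; rewrite 1?addrC 1?mulrC.
set m := `|l - l2| in le12 *; set L := `|l| => el1 el2 Eu Ev uY vY.
have Y0 : 0 <= Y := le_trans (normr_ge0 u) uY.
have m0 : 0 < m := lt_le_trans e0 el2.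
have L0 : 0 <= L := normr_ge0 l.
have l1m : `|l1| <= m + L.
  rewrite -[l1](subKr l) (le_trans (ler_normB _ _))// addrC.
  by rewrite lerD2r.
have l2m : `|l2| <= m + L.
  by rewrite -[l2](subKr l) (le_trans (ler_normB _ _))// addrC.
have bm : `|b| <= m + L.
  rewrite -ler_sqr ?nnegrE ?addr_ge0 ?(ltW m0)// expr2 -{2}cb -normrM.
  by rewrite -normrN -l12M normrM expr2 ler_pM.
have dm : `|d - l| <= 2 * m + L.
  have -> : d - l = - (l - l1) - (l - l2) + l by rewrite -l12; ring.
  rewrite (le_trans (ler_normD _ _))// lerD2r (le_trans (ler_normB _ _))//.
  by rewrite normrN mulr_natl mulr2n lerD2r.
(* The determinant of the system; its lower bound e * m enters through main. *)
pose det := (l - l1) * (l - l2).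
have detE : det = - l * (d - l) - b * c.
  by rewrite -l12M /det -l12; ring.
have main z : `|det * z| <= (3 * m + 2 * L) * Y ->
    e ^+ 2 * `|z| <= (3 * e + 2 * L) * Y.
  move=> hz; rewrite -(ler_pM2l m0).
  have hz' : e * m * `|z| <= (3 * m + 2 * L) * Y.
    apply: le_trans hz; rewrite !normrM ler_wpM2r//.
    by rewrite ler_wpM2r// ltW.
  have -> : m * (e ^+ 2 * `|z|) = e * (e * m * `|z|) by ring.
  apply: (le_trans (ler_wpM2l (ltW e0) hz')).
  rewrite !mulrA ler_wpM2r// !mulrDr.
  have -> : m * (3 * e) = e * (3 * m) by ring.
  by rewrite lerD2l mulrCA [leRHS]mulrCA ler_wpM2l// ler_wpM2r.
have splitY (x y X1 X2 : C) : `|x| <= X1 -> `|y| <= X2 ->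
    `|x * u| + `|y * v| <= (X1 + X2) * Y.
  by move=> xX yX; rewrite !normrM mulrDl lerD// ler_pM.
split; apply: main.
- have -> : det * p = (d - l) * u - b * v by rewrite detE -Eu -Ev; ring.
  rewrite (le_trans (ler_normB _ _))// (le_trans (splitY _ _ _ _ dm bm))//.
  by rewrite ler_wpM2r// le_eqVlt; apply/orP; left; apply/eqP; ring.
- have -> : det * q = - (c * u) - l * v by rewrite detE -Eu -Ev; ring.
  rewrite (le_trans (ler_normB _ _))// normrN.
  rewrite (le_trans (splitY c l (m + L) L _ _))//; first by rewrite cb.
  rewrite ler_wpM2r//.
  have -> : 3 * m + 2 * L = m + L + L + 2 * m by ring.
  by rewrite lerDl mulr_ge0// ltW.
Qed.

(** * The energy space *)

Lemma inner_CauchySchwarz {R : realType} {H : hilbertType R} (x y : H) :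
  `|inner x y| <= `|x| * `|y|.
Proof.
have [->|y0] := eqVneq y 0; first by rewrite linear0r !normr0 mulr0.
have yy0 : inner y y != 0 by rewrite -normE_inner sqrf_eq0 normr_eq0.
rewrite -ler_sqr ?nnegrE ?mulr_ge0// exprMn !normE_inner.
pose a := inner x y / inner y y; pose w := x - a *: y.
have wy : inner w y = 0 by rewrite linearBl/= linearZl_LR/= divfK// subrr.
have yw : inner y w = 0 by rewrite hermC /= wy rmorph0 mulr0.
have xE : x = w + a *: y by rewrite subrK.
have axy : inner x y = a * inner y y by rewrite /a divfK.
clearbody w a.
have -> : inner x x = inner w w + `|a| ^+ 2 * inner y y.
  rewrite xE linearDl/= !linearDr/= !linearZl_LR/= !linearZr_LR/= wy yw.
  by rewrite !mulr0 addr0 add0r -[_ *: _]/(_ * _) mulrA normCKC.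
have inner_ge0 (z : H) : 0 <= inner z z by rewrite -normE_inner exprn_ge0.
rewrite axy normrM exprMn (ger0_norm (inner_ge0 y)) -subr_ge0.
move: (inner w w) (inner y y) (inner_ge0 w) (inner_ge0 y) => W N W0 N0.
have -> : (W + `|a| ^+ 2 * N) * N - `|a| ^+ 2 * N ^+ 2 = W * N by ring.
by rewrite mulr_ge0.
Qed.

Section energy_space_theory.
Context {R : realType} {H : hilbertType R} {A0 : posop H} {S : sqrtop A0}.

Lemma Hhalf_normE (z : Hhalf S) : `|z| = `|S (val z)|.
Proof. by []. Qed.

Lemma sqrtop_valB (x y : Hhalf S) : S (val (x - y)) = S (val x) - S (val y).
Proof. by rewrite raddfB/= appB//; exact: HhalfP. Qed.

(** S is an isometry of H_{1/2} onto H. *)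
Lemma Hhalf_cauchy_cvg (F : set_system (Hhalf S)) :
  ProperFilter F -> cauchy F -> cvg F.
Proof.
move=> FF /cauchyP cF.
pose G : set_system H := (fun z : Hhalf S => S (val z)) @ F.
have /cvg_ex[h Gh] : cvg G.
  apply/cauchy_cvgP/cauchyP => e e0.
  have [z] := cF e e0; rewrite -!ball_normE => Fz; exists (S (val z)).
  have : F [set y | `|S (val z) - S (val y)| < e]; last by [].
  apply: filterS Fz => y; rewrite /ball_ /= => zy.
  by have := sqrtop_valB z y => /= <-.
have [w dw Sw] := sqrtop_surj S h.
apply/cvg_ex; exists (Defs.lift w : Hhalf S); apply/cvgrPdist_lt => e e0.
move/cvgrPdist_lt : Gh => /(_ e e0).
by apply: filterS => z; rewrite Hhalf_normE sqrtop_valB Defs.liftK// Sw.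
Qed.

HB.instance Definition _ := Uniform_isComplete.Build (Hhalf S) Hhalf_cauchy_cvg.

Lemma sqrtop_sym (x y : H) : dom S x -> dom S y ->
  inner (S x) y = inner x (S y).
Proof.
move=> dx dy; have [_ SS] := sqrtop_selfadjoint S.
have : graph S (y, S y) by [].
by rewrite -SS => /(_ x dx).
Qed.

(** The form of A0 extends to the form domain, which is the domain of S. *)
Lemma posop_sqrtop (x y : H) : dom A0 x -> dom S y ->
  inner (A0 x) y = inner (S x) (S y).
Proof.
move=> dx dy; rewrite -(sqrtop_sqr S dx) sqrtop_sym//.
by move: dx; rewrite (sqrtop_dom S) => -[].
Qed.

(** H_{1/2} embeds continuously into H, with C = c^(-1/2) for the constant c of
    uniform positivity.  That constant speaks of the domain of A0 only; for x in
    the domain of S, take k = A0^-1 x.  Then c |S k|^2 = c <x, k> <= |x|^2 and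
    |x|^2 = <A0 k, x> = <S k, S x>, whence c |x|^2 <= |S x|^2. *)
Lemma Hhalf_norm_val_le : exists2 C : R[i], 0 < C &
  forall z : Hhalf S, `|val z| <= C * `|z|.
Proof.
have [c c0 Ac] := posop_uniformly_positive A0.
exists (sqrtC c^-1); first by rewrite sqrtC_gt0 invr_gt0.
move=> z; rewrite Hhalf_normE; have dz := HhalfP z; set x := val z in dz *.
have [r [_ /(_ x) [dk]]] := posop_resolvent0 A0; set k := r x in dk *.
rewrite scale0r subr0 => Ak _.
have dSk : dom S k by move: dk; rewrite (sqrtop_dom S) => -[].
have xk0 : 0 <= inner x k.
  by rewrite -Ak (le_trans _ (Ac _ dk))// mulr_ge0 ?exprn_ge0// ltW.
have kx : c * `|k| <= `|x|.
  have [->|k0] := eqVneq k 0; first by rewrite normr0 mulr0.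
  rewrite -(ler_pM2r (_ : 0 < `|k|)) ?normr_gt0// -mulrA -expr2.
  rewrite (le_trans (Ac _ dk))// Ak (le_trans _ (inner_CauchySchwarz _ _))//.
  by rewrite ger0_norm.
have Sk : c * `|S k| ^+ 2 <= `|x| ^+ 2.
  rewrite normE_inner -posop_sqrtop// Ak -(ger0_norm xk0).
  apply: (le_trans (ler_wpM2l (ltW c0) (inner_CauchySchwarz _ _))).
  by rewrite mulrCA expr2 ler_wpM2l.
have [->|x0] := eqVneq x 0.
  by rewrite normr0 mulr_ge0// sqrtC_ge0 invr_ge0 ltW.
have xSx : `|x| ^+ 2 <= `|S k| * `|S x|.
  rewrite normE_inner -{1}Ak posop_sqrtop//.
  rewrite (le_trans _ (inner_CauchySchwarz _ _))//.
  by rewrite ger0_norm// -posop_sqrtop// Ak -normE_inner exprn_ge0.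
have x20 : 0 < `|x| ^+ 2 by rewrite exprn_gt0// normr_gt0.
rewrite -ler_sqr ?nnegrE ?mulr_ge0 ?sqrtC_ge0 ?invr_ge0 ?(ltW c0)//.
rewrite exprMn sqrtCK ler_pdivlMl// -(ler_pM2l x20).
rewrite mulrCA (le_trans (_ : _ <= c * (`|S k| * `|S x|) ^+ 2))//.
  by rewrite ler_pM2l// -expr2 ler_sqr ?nnegrE ?mulr_ge0// exprn_ge0.
by rewrite exprMn mulrA ler_wpM2r// exprn_ge0.
Qed.

Lemma Hhalf_val_lift (z : Hhalf S) : Defs.lift (val z) = z :> Hhalf S.
Proof. by apply: val_inj; rewrite Defs.liftK//; exact: HhalfP. Qed.

(** S maps H_1 onto its own domain, which is dense in H, and S is isometric from
    H_{1/2} to H. *)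
Lemma H1_dense (z : Hhalf S) (e : R[i]) : 0 < e ->
  exists2 g : Hhalf S, H1 g & `|z - g| < e.
Proof.
move=> e0; have [dS _] := sqrtop_selfadjoint S.
have [|h [/=]] := dS (ball (S (val z)) e) _ (ball_open (S (val z)) e).
  by exists (S (val z)); exact: ballxx.
rewrite -ball_normE /= => zh dh.
have [w dw Sw] := sqrtop_surj S h.
exists (Defs.lift w : Hhalf S).
  by rewrite /H1 /= (sqrtop_dom S)/= Defs.liftK// Sw.
by rewrite Hhalf_normE sqrtop_valB Defs.liftK// Sw.
Qed.

End energy_space_theory.

(** * The block operator and its quadratic numerical range *)

Section block_operator_theory.
Context {R : realType} {H : hilbertType R} {A0 : posop H} {S : sqrtop A0}.
Context {Hm : Hneg S}.
Context {A0x D : {linear Hhalf S -> Hm}}.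
Hypothesis A0x_bounded : bounded_near A0x (nbhs (0 : Hhalf S)).
Hypothesis A0x_ext : forall z : Hhalf S, H1 z -> A0x z = embed Hm (A0 (val z)).
Hypothesis D_bounded : bounded_near D (nbhs (0 : Hhalf S)).
Hypothesis D_H1 : forall z : Hhalf S, H1 z -> range (embed Hm) (D z).

Let A := block_op A0x D.

Lemma block_op_H1 (f g : Hhalf S) (h : H) : H1 f -> D g = embed Hm h ->
  dom A (f, val g) /\ A (f, val g) = (g, - (A0 (val f) + h)).
Proof.
move=> f1 Dg.
have E : A0x f + D (Defs.lift (val g)) = embed Hm (A0 (val f) + h).
  by rewrite Hhalf_val_lift A0x_ext// Dg linearD.
split; first by split; [exact: HhalfP|exists (A0 (val f) + h)].
by rewrite /A /= /block_app /= E embedK Hhalf_val_lift.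
Qed.

(** The main estimate, obtained by pairing the two components of A x - l x with
    f / |f| and g / |g|. *)
Lemma qnr_lower_bound (f g : Hhalf S) (l e : R[i]) :
    H1 f -> H1 g -> f != 0 -> g != 0 -> 0 < e ->
    (forall m, qnr D m -> e <= `|l - m|) ->
  e ^+ 2 * `|(f, val g)| <=
  (3 * e + 2 * `|l|) * `|A (f, val g) - l *: (f, val g)|.
Proof.
move=> f1 g1 f0 g0 e0 el; have [h _ /esym Dg] := D_H1 _ g1.
have [_ ->] := block_op_H1 _ _ _ f1 Dg.
set p := `|f|; set q := `|val g|.
have p0 : 0 < p by rewrite normr_gt0.
have q0 : 0 < q.
  rewrite normr_gt0; apply: contraNneq g0 => g0; apply/eqP; exact: val_inj.
have pn := lt0r_neq0 p0; have qn := lt0r_neq0 q0.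
pose M := qnr_mx D f g.
have [l1 [l2 [l12 l12M]]] := quadratic_roots (M 1 1) (- (M 0 1 * M 1 0)).
have M00 : M 0 0 = 0 by rewrite mxE.
have qnrP m m' : m + m' = M 1 1 -> m * m' = - (M 0 1 * M 1 0) -> e <= `|l - m|.
  move=> mm' mm'M; apply: el; exists f, g; split=> //; apply: eigenvalue_mx2.
  by rewrite -/M M00 -mm' -[RHS]opprK -mm'M; ring.
set Y := `|_ - l *: _|.
have [Y1 Y2] : `|g - l *: f| <= Y /\ `|- (A0 (val f) + h) - l *: val g| <= Y.
  exact: (prod_norm_ge
    ((g, - (A0 (val f) + h)) - l *: (f, val g) : Hhalf S * H)).
have [||||||||||] := @mx2_solution_bound _ l l1 l2 (M 0 1) (M 1 0) (M 1 1)
  (- l * p + M 0 1 * q) (M 1 0 * p + (M 1 1 - l) * q) p q e Y.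
- have fS : dom S (val f) := HhalfP f.
  rewrite !mxE /= (posop_sqrtop (S := S))//; last exact: HhalfP.
  by rewrite normrN !normrM hermC expr0 mul1r norm_conjC.
- by [].
- by [].
- by [].
- exact: qnrP l12 l12M.
- by apply: (qnrP l2 l1); [rewrite addrC|rewrite mulrC].
- by [].
- by [].
- have -> : - l * p + M 0 1 * q = inner (S (val (g - l *: f))) (S (val f)) / p.
    have -> : S (val (g - l *: f)) = S (val g) - l *: S (val f).
      by rewrite sqrtop_valB linearZ/= appZ//; exact: HhalfP.
    rewrite linearBl/= linearZl_LR/= -normE_inner -[`|S (val f)|]/p mxE/=.
    by rewrite /Hhalf_inner -/p -/q; field; rewrite pn qn.
  rewrite normrM normfV [`|p|]gtr0_norm// ler_pdivrMr//.
  by rewrite (le_trans (inner_CauchySchwarz _ _))// ler_wpM2r.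
- have innerE : inner (- (A0 (val f) + h) - l *: val g) (val g) =
      - (inner (A0 (val f)) (val g) + inner h (val g)) - l * q ^+ 2.
    by rewrite linearBl/= linearZl_LR/= linearNl/= linearDl/= -normE_inner.
  have -> : M 1 0 * p + (M 1 1 - l) * q =
      inner (- (A0 (val f) + h) - l *: val g) (val g) / q.
    rewrite innerE !mxE/= Dg pairing_embed -/p -/q.
    by field; rewrite pn qn.
  rewrite normrM normfV [`|q|]gtr0_norm// ler_pdivrMr//.
  by rewrite (le_trans (inner_CauchySchwarz _ _))// ler_wpM2r.
- rewrite !normr_id => hp hq.
  exact: (@prod_norm_ind _ _ _ (fun r => e ^+ 2 * r <= _)).
Qed.

(** A0x is an isometry on H_1, because embed (S w) has norm |w|, and H_1 is
    dense. *)
Lemma norm_le_A0x (z : Hhalf S) : `|z| <= `|A0x z|.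
Proof.
have /linear_boundedP/pinfty_ex_gt0[M M0 AM] := A0x_bounded.
apply/ler_addgt0Pl => e e0.
have M1 : 0 < M + 1 by rewrite addr_gt0.
have [g g1 zg] := H1_dense z _ (divr_gt0 e0 M1).
have Ag : `|A0x g| = `|g|.
  have := g1; rewrite /H1 /= (sqrtop_dom S) => -[_ dSg].
  by rewrite A0x_ext// -(sqrtop_sqr S)// embed_norm.
rewrite -[z in `|z|](subrK g) (le_trans (ler_normD _ _))// -Ag.
rewrite -[g in `|A0x g|](subKr z) linearB.
rewrite (le_trans (lerD (lexx _) (ler_normB _ _)))// addrCA addrC lerD2r.
rewrite (le_trans (lerD (lexx _) (AM _)))//.
rewrite -{1}[`|z - g|]mul1r -mulrDl addrC.
by rewrite -ler_pdivlMl// mulrC ltW.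
Qed.

(** H_1 x H_1 is a core.  Given g close to the second component w, the vector f
    solves A0x f + D g = A0x z + D w, so that A does not change in its second
    component and A0x (z - f) = D (g - w) is small. *)
Lemma block_op_core (x : Hhalf S * H) (e : R[i]) : dom A x -> 0 < e ->
  exists f g : Hhalf S, [/\ H1 f, H1 g, `|x - (f, val g)| <= e &
    `|A x - A (f, val g)| <= e].
Proof.
case: x => z w dx e0; have [/= dw [h _ hE]] := dx.
have /linear_boundedP/pinfty_ex_gt0[M M0 DM] := D_bounded.
have [C C0 HC] := @Hhalf_norm_val_le _ _ _ S.
(* One constant for the three estimates: in H_{1/2} for w, in H through the
   embedding, and in H_{-1/2} through D. *)
have B0 : 0 < 1 + M + C by rewrite !addr_gt0.
have [g g1 /ltW wg] := H1_dense (Defs.lift w : Hhalf S) _ (divr_gt0 e0 B0).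
have small y : 0 < y -> y <= 1 + M + C -> y * `|Defs.lift w - g| <= e.
  move=> y0 yB; rewrite (le_trans (ler_wpM2l (ltW y0) wg))//.
  by rewrite mulrA ler_pdivrMr// mulrC ler_pM2l.
have [k _ kE] := D_H1 _ g1.
have [r [_ /(_ (h - k))[df Af] _]] := posop_resolvent0 A0.
rewrite scale0r subr0 in Af.
have dSf : dom S (r (h - k)) by move: df; rewrite (sqrtop_dom S) => -[].
pose f : Hhalf S := Defs.lift (r (h - k)).
have f1 : H1 f by rewrite /H1 /= Defs.liftK.
have A0f : A0 (val f) = h - k by rewrite Defs.liftK.
have [_ Afg] := block_op_H1 _ _ _ f1 (esym kE).
exists f, g; split=> //.
- apply: (@prod_norm_ind _ _ _ (fun s => s <= e)) => /=.
    rewrite (le_trans (norm_le_A0x _))// linearB (A0x_ext _ f1) A0f linearB.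
    rewrite hE kE opprB [X in _ + X]addrC opprD addrA addrA subrr sub0r.
    rewrite addrC -linearB (le_trans (DM _))// distrC small//.
    by rewrite [1 + M]addrC -addrA lerDl addr_ge0// ltW.
  have -> : w - sval g = val (Defs.lift w - g : Hhalf S).
    by rewrite raddfB/= -{1}(Defs.liftK dw).
  rewrite (le_trans (HC _))// small//.
  by rewrite lerDr addr_ge0// ltW.
- have Azw : A (z, w) = (Defs.lift w : Hhalf S, - h).
    by rewrite /A /= /block_app /= -hE embedK.
  rewrite -[X in `|X - _|]/(A (z, w)) -[X in `|_ - X|]/(A (f, val g)).
  rewrite Azw Afg A0f subrK.
  apply: (@prod_norm_ind _ _ _ (fun s => s <= e)) => /=.
    by rewrite -[`|_|]mul1r small// -addrA lerDl addr_ge0// ltW.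
  by rewrite subrr normr0 ltW.
Qed.

(** When f or g vanishes, it is replaced by a small multiple of the other one,
    which is a nonzero element of H_1 unless the whole vector is 0. *)
Lemma block_op_lower_bound_H1 (f g : Hhalf S) (l e : R[i]) :
    H1 f -> H1 g -> 0 < e -> (forall m, qnr D m -> e <= `|l - m|) ->
  e ^+ 2 * `|(f, val g)| <=
  (3 * e + 2 * `|l|) * `|A (f, val g) - l *: (f, val g)|.
Proof.
move=> f1 g1 e0 el.
have a0 : 0 <= e ^+ 2 by rewrite exprn_ge0// ltW.
have b0 : 0 <= 3 * e + 2 * `|l| by rewrite addr_ge0// mulr_ge0// ltW.
have dH1 (f' g' : Hhalf S) : H1 f' -> H1 g' -> dom A (f', val g').
  by move=> f1' /D_H1[h _ /esym Dg]; have [] := block_op_H1 _ _ _ f1' Dg.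
have H10 : H1 (0 : Hhalf S) by exact: dom0.
have H1Z (t : R[i]) (z : Hhalf S) : H1 z -> H1 (t *: z).
  by move=> z1; have := dom_lin t z1 H10; rewrite addr0 -linearZ.
have [->|g0] := eqVneq g 0.
  have [->|f0] := eqVneq f 0.
    by rewrite normr0 mulr0 mulr_ge0.
  apply: (@lower_bound_perturb _ _ A l _ _ _ (0, val f)) => //; try exact: dH1.
  move=> t t0.
  have -> : t *: (0, val f) + (f, val (0 : Hhalf S)) = (f, val (t *: f)).
    by apply: injective_projections; rewrite /= ?addr0// scaler0 add0r.
  by apply: qnr_lower_bound => //; [exact: H1Z|rewrite scaler_eq0 negb_or t0].
have [->|f0] := eqVneq f 0; last exact: qnr_lower_bound.
apply: (@lower_bound_perturb _ _ A l _ _ _ (g, val (0 : Hhalf S))) => //;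
  try exact: dH1.
move=> t t0.
have -> : t *: (g, val (0 : Hhalf S)) + (0, val g) = (t *: g, val g).
  by apply: injective_projections; rewrite /= ?addr0// scaler0 add0r.
by apply: qnr_lower_bound => //; [exact: H1Z|rewrite scaler_eq0 negb_or t0].
Qed.

Lemma block_op_lower_bound (x : Hhalf S * H) (l e : R[i]) :
    dom A x -> 0 < e -> (forall m, qnr D m -> e <= `|l - m|) ->
  e ^+ 2 * `|x| <= (3 * e + 2 * `|l|) * `|A x - l *: x|.
Proof.
move=> dx e0 el; apply: lower_bound_approx => //.
- by rewrite exprn_ge0// ltW.
- by rewrite addr_ge0// mulr_ge0// ltW.
move=> d d0; have [f [g [f1 g1 xfg Axfg]]] := block_op_core _ _ dx d0.
exists (f, val g); split=> //; last exact: block_op_lower_bound_H1.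
by have [h _ /esym Dg] := D_H1 _ g1; have [] := block_op_H1 _ _ _ f1 Dg.
Qed.

(** Points of the ball of radius e / 2 about l stay at distance e / 2 from the
    quadratic numerical range, and their modulus is at most |l| + e / 2. *)
Lemma block_op_lower_bound_near (l : R[i]^o) : (~` closure (qnr D)) l ->
  exists2 k, 0 < k &
    \forall m \near l, forall x, dom A x -> k * `|x| <= `|A x - m *: x|.
Proof.
move=> /existsNP[B /not_implyP[/nbhs_ballP[e /= e0 leB]]].
move=> /set0P/negP/negPn/eqP qB.
have e2 : 0 < e / 2 by rewrite divr_gt0.
pose K := 3 * (e / 2) + 2 * (`|l| + e / 2).
have K0 : 0 < K by rewrite ltr_pwDl ?mulr_gt0// mulr_ge0// addr_ge0// ltW.
exists ((e / 2) ^+ 2 / K); first by rewrite divr_gt0// exprn_gt0.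
apply/nbhs_ballP; exists (e / 2) => //= m; rewrite -ball_normE /= => lm x dx.
have far n : qnr D n -> e / 2 <= `|m - n|.
  move=> qn; have : e <= `|l - n|.
    rewrite real_leNgt ?(gtr0_real e0) ?normr_real//; apply/negP => ln.
    suff : (qnr D `&` B) n by rewrite qB.
    by split=> //; apply: leB; rewrite -ball_normE.
  move=> eln; rewrite -(lerD2l (e / 2)) -splitr (le_trans eln)//.
  rewrite (le_trans (ler_distD m _ _))//.
  by rewrite lerD2r ltW.
rewrite mulrAC ler_pdivrMr// [leRHS]mulrC.
rewrite (le_trans (block_op_lower_bound _ _ _ dx e2 far))//.
rewrite ler_wpM2r// lerD2l ler_wpM2l// -lerBlDl.
by rewrite (le_trans (lerB_dist _ _))// distrC ltW.
Qed.

End block_operator_theory.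

Theorem theorem5p4 (R : realType) (H : hilbertType R) (A0 : posop H)
    (S : sqrtop A0) (Hm : Hneg S)
    (A0x : {linear Hhalf S -> Hm})
    (A0x_bounded : bounded_near A0x (nbhs (0 : Hhalf S)))
    (A0x_ext : forall z : Hhalf S, H1 z -> A0x z = embed Hm (A0 (val z)))
    (D : {linear Hhalf S -> Hm})
    (D_bounded : bounded_near D (nbhs (0 : Hhalf S)))
    (D_accretive : forall z : Hhalf S, 0 <= 'Re (pairing Hm (D z) z))
    (D_H1 : forall z : Hhalf S, H1 z -> range (embed Hm) (D z)) :
  let A := block_op A0x D in
  let W2 := closure (qnr D) in
  (forall Omega : set R[i]^o, is_component (~` W2) Omega ->
     Omega `&` resolvent_set A !=set0 -> Omega `<=` resolvent_set A) /\
  ((forall Omega : set R[i]^o, is_component (~` W2) Omega ->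
     Omega `&` resolvent_set A !=set0) -> spectrum A `<=` W2).
Proof.
move=> A W2.
have main Omega : is_component (~` W2) Omega ->
    Omega `&` resolvent_set A !=set0 -> Omega `<=` resolvent_set A.
  move=> [l0 _ ->]; apply: resolvent_set_connected.
    exact: component_connected.
  move=> l /connected_component_sub; exact: block_op_lower_bound_near.
split=> // allOmega l; apply: contra_notP => W2l.
have comp : is_component (~` W2) (connected_component (~` W2) l) by exists l.
exact: (main _ comp (allOmega _ comp)) (connected_component_refl W2l).
Qed.
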